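(* Let $0 < \theta_2 = p_2 \le p_1 = \theta_1 < \infty$. Assume that $v_1, v_2 \in \mathcal{W}(\mathbb{R}^n)$, $\omega_1 \in {}^{\mathbf c}\Omega_{\theta_1}$ and $\omega_2 \in \Omega_{\theta_2}$. Then $$\|\mathrm{I}\|_{{}^{\mathbf c}LM_{p_1\theta_1,\omega_1}(\mathbb{R}^n,v_1)\to LM_{p_2\theta_2,\omega_2}(\mathbb{R}^n,v_2)} \approx \Big\| \|\omega_1\|_{p_1,(0,|\cdot|)}^{-1}\, \|\omega_2\|_{p_2,(|\cdot|,\infty)} \Big\|_{p_1\to p_2,\, v_1^{-1}v_2,\, \mathbb{R}^n}.$$
   Context: Let $n\ge 1$. For measurable $A$ (in $\mathbb{R}^n$ or $\mathbb{R}$), $\mathfrak{M}(A)$ is the set of measurable functions on $A$, $\mathfrak{M}^+(A)$ the non-negative ones, and $\mathcal{W}(A)$ the set of weights: measurable functions that are positive and finite a.e. on $A$. For $p\in(0,\infty]$, $\|f\|_{p,A}=(\int_A|f|^p)^{1/p}$ if $p<\infty$ and $\|f\|_{\infty,A}=\operatorname{ess\,sup}_A|f|$. For a non-negative measurable $w$, $\|f\|_{p,w,A}:=\|fw\|_{p,A}$ (the weight is inside the power). $B(0,t)$ is the open ball of radius $t$ centred at $0$ and ${}^{\mathbf c}B(0,t)=\mathbb{R}^n\setminus B(0,t)$. For $0<p,\theta\le\infty$, $\omega\in\mathfrak{M}^+(0,\infty)$, $v\in\mathcal{W}(\mathbb{R}^n)$: - $LM_{p\theta,\omega}(\mathbb{R}^n,v)$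 is the set of $f\in L^{\rm loc}_{p,v}(\mathbb{R}^n)$ (i.e. $\|f\|_{p,v,K}<\infty$ for compact $K$) with $\|f\|_{LM_{p\theta,\omega}(\mathbb{R}^n,v)}:=\big\|\,t\mapsto\|f\|_{p,v,B(0,t)}\big\|_{\theta,\omega,(0,\infty)}<\infty$; - ${}^{\mathbf c}LM_{p\theta,\omega}(\mathbb{R}^n,v)$ is the set of $f\in\bigcap_{t>0}L_{p,v}({}^{\mathbf c}B(0,t))$ (i.e. $\|f\|_{p,v,{}^{\mathbf c}B(0,t)}<\infty$ for all $t>0$) with $\|f\|_{{}^{\mathbf c}LM_{p\theta,\omega}(\mathbb{R}^n,v)}:=\big\|\,t\mapsto\|f\|_{p,v,{}^{\mathbf c}B(0,t)}\big\|_{\theta,\omega,(0,\infty)}<\infty$. $\Omega_\theta=\{\omega\in\mathfrak{M}^+(0,\infty):0<\|\omega\|_{\theta,(t,\infty)}<\infty\ \forall t>0\}$ and ${}^{\mathbf c}\Omega_\theta=\{\omega\in\mathfrak{M}^+(0,\infty):0<\|\omega\|_{\theta,(0,t)}<\infty\ \forall t>0\}$. $\|\mathrm{I}\|_{X\to Y}\in[0,\infty]$ is the least constant $c$ with $\|f\|_Y\le c\|f\|_X$ for all $f\in X$ ($\infty$ if there is none). For $0<p,q\le\infty$, the symbol $p\to q$ used as an exponent denotes the number defined by $\frac1{p\to q}=\frac1q-\frac1p$ if $q<p$, and $p\to q=\infty$ if $q\ge p$. $A\approx B$ means $\lambda^{-1}B\le A\le\lambda B$ with $\lambda\ge1$ depending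 only on inessential parameters, i.e. on $n$ and the exponents $p_i,\theta_i$, but not on the weights (in particular one side is infinite iff the other is). Conventions: $0/0=0$, $0\cdot(\pm\infty)=0$, $1/(\pm\infty)=0$. *)

(* Defs.v *)
From HB Require Import structures.
From mathcomp Require Import all_boot all_order all_algebra.
From mathcomp Require Import all_classical all_reals all_analysis.
From mathcomp Require Import measurable_realfun.

Set Implicit Arguments.
Unset Strict Implicit.
Unset Printing Implicit Defensive.

Import Order.TTheory GRing.Theory Num.Theory.
Import numFieldNormedType.Exports.

Local Open Scope classical_set_scope.
Local Open Scope ring_scope.
Local Open Scope ereal_scope.

(* The library has Lebesgue measure on R only. On R^(n.+1) we take the measure
   obtained by the Caratheodory construction from the outer measure
     A |-> inf { \sum_k vol(Q_k) : A included in the union of the Q_k },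
   the Q_k being half-open boxes ]a, b]. *)
Section lebesgue_outer.
Context {R : realType} {n : nat}.
Implicit Types (Q : 'rV[R]_n.+1 * 'rV[R]_n.+1) (A : set 'rV[R]_n.+1).

Definition box Q : set 'rV[R]_n.+1 :=
  [set x | forall i, (Q.1 ord0 i < x ord0 i <= Q.2 ord0 i)%R].

Definition box_volume Q : R :=
  (\prod_i Num.max (Q.2 ord0 i - Q.1 ord0 i) 0)%R.

Definition box_cover A : set (nat -> 'rV[R]_n.+1 * 'rV[R]_n.+1) :=
  [set Q | A `<=` \bigcup_k box (Q k)].

Definition lebesgue_outer A : \bar R :=
  ereal_inf [set \sum_(k <oo) (box_volume (Q k))%:E | Q in box_cover A].

Lemma box_volume_ge0 Q : (0 <= box_volume Q)%R.
Proof. by apply: prodr_ge0 => i _; rewrite le_max lexx orbT. Qed.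

Let vol Q := (box_volume Q)%:E.

Let vol_ge0 Q : 0 <= vol Q. Proof. by rewrite lee_fin box_volume_ge0. Qed.

Lemma lebesgue_outer_ge0 A : 0 <= lebesgue_outer A.
Proof.
apply: le_ereal_inf_tmp => x [Q _ <-{x}].
by apply: nneseries_ge0 => k _ _; exact: vol_ge0.
Qed.

Lemma lebesgue_outer0 : lebesgue_outer set0 = 0.
Proof.
apply/eqP; rewrite eq_le; apply/andP; split; last exact: lebesgue_outer_ge0.
apply: ereal_inf_lbound; exists (fun=> (0%R, 0%R)); first by [].
apply: eseries0 => k _ _; congr EFin.
by rewrite /box_volume (bigD1 ord0)//= subrr maxxx mul0r.
Qed.

Lemma le_lebesgue_outer : {homo lebesgue_outer : A B / A `<=` B >-> A <= B}.
Proof.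
move=> A B AB; apply/ereal_inf_le_tmp => x [Q BQ <-{x}].
by exists Q => //; apply: subset_trans AB BQ.
Qed.

Lemma lebesgue_outer_sigma_subadditive : sigma_subadditive lebesgue_outer.
Proof.
move=> A; have [[i ioo]|] := pselect (exists i, lebesgue_outer (A i) = +oo).
  rewrite (eseries_pinfty _ _ ioo) ?leey// => m _.
  by rewrite -ltNye (lt_le_trans _ (lebesgue_outer_ge0 _)).
rewrite -forallNE => Aoo.
suff add2e (e : {posnum R}) : lebesgue_outer (\bigcup_m A m) <=
    \sum_(i <oo) lebesgue_outer (A i) + e%:num%:E.
  by apply/lee_addgt0Pr => _/posnumP[].
rewrite (le_trans _ (epsilon_trick _ _ _))//; last first.
  by move=> m; exact: lebesgue_outer_ge0.
pose P m (Q : nat -> 'rV[R]_n.+1 * 'rV[R]_n.+1) := box_cover (A m) Q /\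
  \sum_(k <oo) vol (Q k) <= lebesgue_outer (A m) + (e%:num / (2 ^ m.+1)%:R)%:E.
have [G PG] : {G : nat -> nat -> _ & forall m, P m (G m)}.
  apply: (@choice _ _ P) => m; rewrite /P.
  have fin : lebesgue_outer (A m) \is a fin_num.
    rewrite ge0_fin_numE ?lebesgue_outer_ge0// ltNge leye_eq.
    by apply/eqP; exact: Aoo.
  have en1 : (0 < e%:num / (2 ^ m.+1)%:R)%R by [].
  have [x [Q AQ Qx] xS] := lb_ereal_inf_adherent en1 fin.
  by exists Q; split => //; rewrite Qx; exact/ltW.
have muG_ge0 x : 0 <= (vol \o uncurry G) x by exact: vol_ge0.
apply: (@le_trans _ _ (\esum_(i in setT) (vol \o uncurry G) i)).
  apply: ereal_inf_lbound => /=.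
  have /card_esym/ppcard_eqP[f] := card_nat2.
  exists (uncurry G \o f).
    move=> t [i _] /(PG i).1[j _ Bijt]; exists (f^-1%FUN (i, j)) => //=.
    by rewrite invK ?inE.
  rewrite -(esum_pred_image (vol \o uncurry G) _ xpredT) ?[fun=> _]set_true//.
  by rewrite image_eq.
rewrite (_ : esum _ _ = \sum_(i <oo) \sum_(j <oo) vol (G i j)); last first.
  pose J : nat -> set (nat * nat) := fun i => [set (i, j) | j in setT].
  rewrite (_ : setT = \bigcup_k J k); last first.
    by rewrite predeqE => -[a b]; split => // _; exists a => //; exists b.
  rewrite esum_bigcupT /=; last 2 first.
    - apply/trivIsetP => i j _ _ ij.
      rewrite predeqE => -[p q] /=; split => //= -[] [_] _ [<-{p} _].
      by move=> [m' _] [] /esym/eqP; rewrite (negbTE ij).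
    - by move=> /= [p q]; exact: vol_ge0.
  rewrite -(image_id [set: nat]) -fun_true esum_pred_image//; last first.
    by move=> p _; exact: esum_ge0.
  apply: eq_eseriesr => /= j _.
  rewrite -(esum_pred_image (vol \o uncurry G) (pair j) predT)//=; last first.
    by move=> ? ? _ _; exact: (@can_inj _ _ _ snd).
  by congr esum; rewrite predeqE => -[a b]; split; move=> [i _ <-]; exists i.
apply: lee_nneseries => [p _ _|p _]; first exact: nneseries_ge0.
exact: (PG p).2.
Qed.

HB.instance Definition _ := isOuterMeasure.Build R 'rV[R]_n.+1 lebesgue_outer
  lebesgue_outer0 lebesgue_outer_ge0 le_lebesgue_outer
  lebesgue_outer_sigma_subadditive.

End lebesgue_outer.

(* R^(n.+1), resp. R, with its Lebesgue measurable sets. *)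
Notation euclid R n := (caratheodory_type (@lebesgue_outer R n)).
Notation line R := (caratheodory_type (@wlength R idfun)^*%mu).

Definition lebesgue_euclid {R : realType} {n : nat} :
  set (euclid R n) -> \bar R := @lebesgue_outer R n.
HB.instance Definition _ (R : realType) (n : nat) :=
  isMeasure.Build _ _ _ (@lebesgue_euclid R n)
    (caratheodory_measure0 (@lebesgue_outer R n))
    (caratheodory_measure_ge0 (mu := @lebesgue_outer R n))
    (@caratheodory_measure_sigma_additive _ _ (@lebesgue_outer R n)).

(* The norm provided by the library on 'rV[R]_n.+1 is the sup norm. *)
Definition euclid_norm {R : realType} {n : nat} (x : 'rV[R]_n.+1) : R :=
  Num.sqrt (\sum_i (x ord0 i) ^+ 2)%R.

Definition ball0 {R : realType} {n : nat} (t : R) : set (euclid R n) :=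
  [set x | (euclid_norm x < t)%R].

Section weighted_norms.
Context d {T : measurableType d} {R : realType}.
Variable mu : {measure set T -> \bar R}.
Implicit Types (p : \bar R) (A : set T) (f w : T -> \bar R).

(* For 0 < p <= +oo, extending f by 0 outside A leaves the integral and the
   essential supremum of |f| over A unchanged. *)
Definition norm_on p A f : \bar R := 'N[mu]_p [f \_ A].

Definition wnorm_on p w A f : \bar R := norm_on p A (fun x => f x * w x).

Definition nonneg_measurable A : set (T -> \bar R) :=
  [set f : T -> \bar R | measurable_fun A f /\ forall x, A x -> 0 <= f x].

Definition weight A : set (T -> \bar R) :=
  [set w : T -> \bar R |
    measurable_fun A w /\ {ae mu, forall x, A x -> 0 < w x < +oo}].

End weighted_norms.

Section morrey.
Context {R : realType}.
Implicit Types (p theta : \bar R) (omega : line R -> \bar R).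

Section spaces.
Context {n : nat}.
Implicit Types (v f : euclid R n -> \bar R).

Definition Lloc p v : set (euclid R n -> \bar R) :=
  [set f | measurable_fun setT f /\
    forall K : set 'rV[R]_n.+1, compact K ->
      wnorm_on lebesgue_euclid p v K f < +oo].

Definition LM_norm p theta omega v f : \bar R :=
  wnorm_on completed_lebesgue_measure theta omega `]0%R, +oo[
    (fun t => wnorm_on lebesgue_euclid p v (ball0 t) f).

Definition LM p theta omega v : set (euclid R n -> \bar R) :=
  [set f | Lloc p v f /\ LM_norm p theta omega v f < +oo].

Definition cLM_norm p theta omega v f : \bar R :=
  wnorm_on completed_lebesgue_measure theta omega `]0%R, +oo[
    (fun t => wnorm_on lebesgue_euclid p v (~` ball0 t) f).

Definition cLM p theta omega v : set (euclid R n -> \bar R) :=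
  [set f | [/\ measurable_fun setT f,
    forall t : R, (0 < t)%R ->
      wnorm_on lebesgue_euclid p v (~` ball0 t) f < +oo &
    cLM_norm p theta omega v f < +oo]].

End spaces.

Definition Omega theta : set (line R -> \bar R) :=
  [set omega : line R -> \bar R |
    nonneg_measurable (T := line R) `]0%R, +oo[ omega /\
    forall t : R, (0 < t)%R ->
      0 < norm_on completed_lebesgue_measure theta `]t, +oo[ omega < +oo].

Definition cOmega theta : set (line R -> \bar R) :=
  [set omega : line R -> \bar R |
    nonneg_measurable (T := line R) `]0%R, +oo[ omega /\
    forall t : R, (0 < t)%R ->
      0 < norm_on completed_lebesgue_measure theta `]0%R, t[ omega < +oo].

(* The exponent written p -> q in the multiplier norm: it is the r with
   1/r = 1/q - 1/p, where 1/+oo = 0. *)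
Definition exp_to (p q : \bar R) : \bar R :=
  if q < p then (q^-1 - p^-1)^-1 else +oo.

End morrey.

(* ||I||_(X -> Y), the norm of the inclusion of X into Y, for spaces of
   functions given by their carriers and their quasi-norms; it is +oo, the
   infimum of the empty set, when no constant is admissible. *)
Definition embedding_norm {R : realType} {F : Type}
    (X : set F) (normX : F -> \bar R) (Y : set F) (normY : F -> \bar R) :
    \bar R :=
  ereal_inf [set c%:E | c in [set c : R | (0 <= c)%R /\
    forall f, X f -> Y f /\ normY f <= c%:E * normX f]].

(* Main.v *)
(** Both spaces are weighted Lebesgue spaces.  Since p = theta, Tonelli's theorem
    turns the norm of the complementary space into the L^p norm of f v1 W1, where
    W1 x is the L^p norm of omega1 on (0, |x|), and the norm of the local space into
    the L^q norm of f v2 W2, where W2 x is the L^q norm of omega2 on (|x|, oo).  The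
    optimal constant from L^p(v1 W1) to L^q(v2 W2) is exactly the L^r norm of
    h = v2 W2 / (v1 W1), 1/r = 1/q - 1/p: Hoelder's inequality gives one bound,
    testing on |h|^(r/p) (on indicators of subsets of {|h| > c} when p = q) the
    other.  Hence the equivalence holds with lambda = 1. *)
From HB Require Import structures.
Require Import Defs.
From mathcomp Require Import all_boot all_order all_algebra.
From mathcomp Require Import all_classical all_reals all_analysis.
From mathcomp Require Import measurable_realfun.
From mathcomp Require Import lra.

Import Order.TTheory GRing.Theory Num.Theory.
Import numFieldNormedType.Exports.

Local Open Scope classical_set_scope.
Local Open Scope ring_scope.
Local Open Scope ereal_scope.

Set Implicit Arguments.
Unset Strict Implicit.
Unset Printing Implicit Defensive.

(** * Inverses and powers of extended reals *)

Section extended_reals.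
Context {R : realType}.
Implicit Types x y : \bar R.

Lemma measurable_fine : measurable_fun [set: \bar R] fine.
Proof. exact: fine_measurable. Qed.

(** Writing [1/x] as [x (x^2)^(-1)] reduces the claim to the measurability of real powers; at 0 both
    expressions are 0. *)
Lemma measurable_invr : measurable_fun [set: R] (@GRing.inv R).
Proof.
rewrite (_ : GRing.inv = fun x : R => (x * (x ^+ 2) `^ (-1))%R); last first.
  apply/funext => x; rewrite powR_inv1 ?sqr_ge0// expr2.
  have [->|x0] := eqVneq x 0%R; first by rewrite invr0 mul0r.
  by rewrite invfM mulrA divff// mul1r.
apply: measurable_funM => //.
apply: (measurableT_comp (measurable_powR (-1))) => //.
Qed.

Lemma measurable_inve : measurable_fun [set: \bar R] (@inve R).
Proof.
(* The last branch also covers [+oo], because [fine +oo = 0] and [0^-1 = 0] in [R]. *)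
rewrite (_ : @inve R = fun x => if x == 0 then +oo else
    if x == -oo then -oo else (fine x)^-1%:E); last first.
  by apply/funext => -[r||]//=; rewrite invr0.
apply: measurable_fun_ifT => //; first exact: measurable_fun_eqe.
apply: measurable_fun_ifT => //; first exact: measurable_fun_eqe.
apply/measurable_EFinP; apply: (measurableT_comp measurable_invr).
exact: measurable_fine.
Qed.

(** Finiteness matters: for [0 * +oo] the left side would be [+oo] and the right side 0. *)
Lemma ge0_inveM x y : 0 <= x < +oo -> 0 <= y < +oo -> (x * y)^-1 = x^-1 * y^-1.
Proof.
case: x => [a||]; case: y => [b||]; rewrite ?ltxx ?andbF ?ltry ?lee_fin ?andbT//.
rewrite -EFinM !inver mulf_eq0.
have [->|a0] := eqVneq a 0%R => //=.
  have [->|b0] := eqVneq b 0%R => //=.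
  by move=> _ b0'; rewrite gt0_mulye// lte_fin invr_gt0 lt_neqAle eq_sym b0.
have [->|b0] := eqVneq b 0%R => //= a0' b0'.
  by rewrite gt0_muley// lte_fin invr_gt0 lt_neqAle eq_sym a0.
by rewrite invfM.
Qed.

Lemma lee_poweR2r (r : R) x y : (0 <= r)%R -> 0 <= x -> x <= y ->
  x `^ r <= y `^ r.
Proof.
move=> r0 x0 xy; apply: gt0_ler_poweR => //; rewrite in_itv/= leey ?andbT//.
exact: le_trans xy.
Qed.

Lemma lee_poweR2rE (r : R) x y : (0 < r)%R -> 0 <= x -> 0 <= y ->
  (x `^ r <= y `^ r) = (x <= y).
Proof.
move=> r0 x0 y0; apply/idP/idP => [|xy]; last by rewrite lee_poweR2r// ltW.
move=> /(@lee_poweR2r r^-1); rewrite -!poweRrM mulfV ?gt_eqF// !poweRe1//.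
by apply; [rewrite invr_ge0 ltW|exact: poweR_ge0].
Qed.

Lemma poweRK (r : R) x : (0 < r)%R -> 0 <= x -> (x `^ r) `^ r^-1 = x.
Proof. by move=> r0 x0; rewrite -poweRrM mulfV ?gt_eqF// poweRe1. Qed.

Lemma poweRVK (r : R) x : (0 < r)%R -> 0 <= x -> (x `^ r^-1) `^ r = x.
Proof. by move=> r0 x0; rewrite -poweRrM mulVf ?gt_eqF// poweRe1. Qed.

Lemma abseM_poweR (r : R) x y : `|x * y| `^ r = `|x| `^ r * `|y| `^ r.
Proof. by rewrite abseM poweRM. Qed.

End extended_reals.

(** * Integral norms of extended real functions *)

Section Lnorm_lemmas.
Context d {T : measurableType d} {R : realType}.
Variable mu : {measure set T -> \bar R}.
Implicit Types (f g : T -> \bar R) (p : \bar R).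

Lemma LnormE (r : R) f : 'N[mu]_r%:E[f] = (\int[mu]_x `|f x| `^ r) `^ r^-1.
Proof. by rewrite unlock. Qed.

Lemma measurable_abse_poweR (r : R) f : measurable_fun setT f ->
  measurable_fun setT (fun x => `|f x| `^ r).
Proof.
move=> mf; apply: (measurableT_comp (measurable_poweR _)).
exact: measurableT_comp.
Qed.

Lemma eq_Lnorm_ae p f g : 0 < p -> measurable_fun setT f ->
  measurable_fun setT g -> {ae mu, forall x, f x = g x} ->
  'N[mu]_p[f] = 'N[mu]_p[g].
Proof.
rewrite unlock; case: p => [r||]// r0 mf mg fg.
  congr (_ `^ _); apply: ge0_ae_eq_integral => //.
  - exact: measurable_abse_poweR.
  - exact: measurable_abse_poweR.
  - by move=> *; exact: poweR_ge0.
  - by move=> *; exact: poweR_ge0.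
  - by apply: filterS fg => x /= ->.
case: ifP => // _; apply: ess_sup_inf.eq_ess_sup.
by apply: filterS fg => x /= ->.
Qed.

(* Unlike [ge0_le_integral], no measurability is assumed. *)
Lemma ge0_le_integralT f g : (forall x, 0 <= f x) -> (forall x, f x <= g x) ->
  \int[mu]_x f x <= \int[mu]_x g x.
Proof.
move=> f0 fg; rewrite !ge0_integralTE// => [|x]; last exact: le_trans (fg x).
apply: ereal_sup_le => _ [h hf <-].
by exists h => // x; exact: le_trans (fg x).
Qed.

Lemma le_Lnorm (r : R) f g : (0 < r)%R -> (forall x, `|f x| <= `|g x|) ->
  'N[mu]_r%:E[f] <= 'N[mu]_r%:E[g].
Proof.
move=> r0 fg; rewrite !LnormE lee_poweR2r ?invr_ge0 ?(ltW r0)//.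
  by apply: integral_ge0 => *; exact: poweR_ge0.
apply: ge0_le_integralT => [x|x]; first exact: poweR_ge0.
by rewrite lee_poweR2r// ltW.
Qed.

Lemma Lnorm_lty (r : R) f : (0 < r)%R ->
  ('N[mu]_r%:E[f] < +oo) = (\int[mu]_x `|f x| `^ r < +oo).
Proof.
move=> r0; apply/idP/idP => [h|h]; last by rewrite LnormE poweR_lty.
by rewrite -powR_Lnorm ?gt_eqF// poweR_lty.
Qed.

(** On [A] one has [|f| <= c^-1 |f w|], so a lower bound for the weight turns a finite weighted norm
    into a finite norm over [A]. *)
Lemma Lnorm_patch_lty (r : R) (A : set T) (f w : T -> \bar R) (c : R) :
  (0 < r)%R -> measurable_fun setT (fun x => f x * w x) ->
  (0 < c)%R -> (forall x, A x -> c%:E <= w x) ->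
  'N[mu]_r%:E[(fun x => f x * w x)] < +oo -> 'N[mu]_r%:E[f \_ A] < +oo.
Proof.
move=> r0 mfw c0 cw; rewrite Lnorm_lty// => fw.
apply: (@le_lt_trans _ _ 'N[mu]_r%:E[(fun x => c^-1%:E * (f x * w x))]).
  apply: le_Lnorm => // x; rewrite patchE; case: ifPn => [/set_mem Ax|_]; last first.
    by rewrite abse0 abse_ge0.
  rewrite muleCA !abseM -[leLHS]mule1 lee_wpmul2l ?abse_ge0//.
  rewrite -abseM gee0_abs; last first.
    by rewrite mule_ge0 ?lee_fin ?invr_ge0 ?(le_trans _ (cw _ Ax)) ?lee_fin ?ltW.
  have -> : 1 = c^-1%:E * c%:E :> \bar R by rewrite -EFinM mulVf// gt_eqF.
  by rewrite lee_wpmul2l ?cw// lee_fin invr_ge0 ltW.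
rewrite Lnorm_lty//.
under eq_integral do rewrite abseM_poweR.
rewrite (ge0_integralZl _ _ (measurable_abse_poweR r mfw)) ?poweR_ge0//; last first.
  by move=> *; exact: poweR_ge0.
by rewrite lte_mul_pinfty ?poweR_ge0// fin_num_poweR.
Qed.

End Lnorm_lemmas.

(** * Lebesgue measure and the Euclidean norm on [R^(n+1)] *)

Section euclidean_space.
Context {R : realType} {n : nat}.
Implicit Types (x : 'rV[R]_n.+1) (Q : 'rV[R]_n.+1 * 'rV[R]_n.+1) (i : 'I_n.+1).

(** [box_lower] and [box_upper] are the pieces of a box cut by the hyperplane [x_i = a]. With
    half-open boxes the pieces are again half-open and disjoint; if the hyperplane misses the box,
    one piece is empty and has volume 0. *)
Definition box_lower i (a : R) Q : 'rV[R]_n.+1 * 'rV[R]_n.+1 :=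
  (Q.1, \row_j if j == i then Num.min (Q.2 ord0 j) a else Q.2 ord0 j)%R.

Definition box_upper i (a : R) Q : 'rV[R]_n.+1 * 'rV[R]_n.+1 :=
  (\row_j (if j == i then Num.max (Q.1 ord0 j) a else Q.1 ord0 j), Q.2)%R.

Lemma box_lowerE i a Q :
  box (box_lower i a Q) = box Q `&` [set x | (x ord0 i <= a)%R].
Proof.
apply/seteqP; split => x /=.
  move=> xQ; split => [j|].
    have := xQ j; rewrite !mxE; case: ifPn => // /eqP ->.
    by rewrite le_min => /and3P[-> ->].
  by have := xQ i; rewrite !mxE eqxx le_min => /and3P[].
move=> [xQ xa] j; rewrite !mxE; case: ifPn => [/eqP ->|_]; last exact: xQ.
by rewrite le_min xa andbT; exact: xQ.
Qed.

Lemma box_upperE i a Q :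
  box (box_upper i a Q) = box Q `&` ~` [set x | (x ord0 i <= a)%R].
Proof.
apply/seteqP; split => x /=.
  move=> xQ; split => [j|].
    have := xQ j; rewrite !mxE; case: ifPn => // /eqP ->.
    by rewrite gt_max => /andP[/andP[-> _] ->].
  have := xQ i; rewrite !mxE eqxx gt_max => /andP[/andP[_]].
  by rewrite ltNge => /negP.
move=> [xQ /negP]; rewrite -ltNge => xa j.
rewrite !mxE; case: ifPn => [/eqP ->|_]; last exact: xQ.
by rewrite gt_max xa andbT; exact: xQ.
Qed.

(** All factors but the [i]-th are common, so this is the additivity of length for []p, q]] cut at
    [a], checked over the possible orderings. *)
Lemma box_volume_split i a Q :
  (box_volume (box_lower i a Q) + box_volume (box_upper i a Q) =
   box_volume Q)%R.
Proof.
have volD Q' : box_volume Q' = (Num.max (Q'.2 ord0 i - Q'.1 ord0 i) 0 *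
    \prod_(j | j != i) Num.max (Q'.2 ord0 j - Q'.1 ord0 j) 0)%R.
  by rewrite /box_volume (bigD1 i).
rewrite !volD !mxE eqxx.
under eq_bigr => j ji do rewrite mxE (negbTE ji).
under [X in (_ + _ * X)%R]eq_bigr => j ji do rewrite mxE (negbTE ji).
rewrite -mulrDl; congr (_ * _)%R.
set p := Q.1 _ _; set q := Q.2 _ _.
rewrite /Order.min /Order.max.
by case: (ltP q a) => ?; case: (ltP p a) => ?; do ![case: ltP => ?]; lra.
Qed.

(* A hyperplane cuts every box of a cover into two boxes of the same total volume. *)
Lemma measurable_half_space i (a : R) :
  measurable ([set x | (x ord0 i <= a)%R] : set (euclid R n)).
Proof.
(* Only superadditivity of the cut has to be shown; subadditivity of the outer measure gives the
   other inequality. *)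
apply: le_caratheodory_measurable => A /=.
apply: le_ereal_inf_tmp => _ [Q AQ <-].
pose QL k := box_lower i a (Q k); pose QU k := box_upper i a (Q k).
apply: (@le_trans _ _ (\sum_(k <oo) (box_volume (QL k))%:E +
                       \sum_(k <oo) (box_volume (QU k))%:E)).
  apply: leeD; apply: ereal_inf_lbound.
  - exists QL => // x [/AQ[k _ Qx] Hx].
    by exists k => //; rewrite /QL box_lowerE.
  - exists QU => // x [/AQ[k _ Qx] Hx].
    by exists k => //; rewrite /QU box_upperE.
rewrite -nneseriesD; last 2 first.
- by move=> *; rewrite lee_fin box_volume_ge0.
- by move=> *; rewrite lee_fin box_volume_ge0.
by under eq_eseriesr do rewrite -EFinD box_volume_split.
Qed.

Lemma measurable_coord i :
  measurable_fun setT (fun x : euclid R n => (x : 'rV[R]_n.+1) ord0 i : R).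
Proof.
apply: (measurability _ (RGenOInfty.measurableE R)) => _ [_ [a ->] <-].
rewrite setTI (_ : _ @^-1` _ = ~` [set x : 'rV[R]_n.+1 | (x ord0 i <= a)%R]).
  by apply: measurableC; exact: measurable_half_space.
apply/seteqP; split => x /=; rewrite in_itv/= andbT.
  by rewrite ltNge => /negP.
by move/negP; rewrite -ltNge.
Qed.

Lemma measurable_euclid_norm :
  measurable_fun setT (euclid_norm : euclid R n -> R).
Proof.
rewrite (_ : euclid_norm =
    fun x : 'rV[R]_n.+1 => ((\sum_i (x ord0 i) ^+ 2) `^ 2^-1)%R); last first.
  apply/funext => x; rewrite powR12_sqrt//.
  by apply: sumr_ge0 => i _; exact: sqr_ge0.
apply: (measurableT_comp (measurable_powR _)).
apply: (@measurable_sum _ (euclid R n) _ _ _ _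
  (fun i (x : 'rV[R]_n.+1) => (x ord0 i ^+ 2)%R)) => i.
by apply: measurable_funX; exact: measurable_coord.
Qed.

Lemma euclid_norm_ge0 x : (0 <= euclid_norm x)%R.
Proof. exact: sqrtr_ge0. Qed.

Lemma le_coord_euclid_norm x i : (`|x ord0 i| <= euclid_norm x)%R.
Proof.
rewrite -sqrtr_sqr ler_sqrt; last by apply: sumr_ge0 => j _; exact: sqr_ge0.
by rewrite (bigD1 i)//= lerDl; apply: sumr_ge0 => j _; exact: sqr_ge0.
Qed.

Lemma lebesgue_outer_box Q : lebesgue_outer (box Q) <= (box_volume Q)%:E.
Proof.
(* The cover is the box itself, padded with degenerate boxes of volume 0. *)
apply: ereal_inf_lbound; exists (fun k => if k == 0%N then Q else (0, 0)%R).
  by move=> x Qx; exists 0%N.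
rewrite nneseries_recl//; last by move=> k _; rewrite lee_fin box_volume_ge0.
rewrite eqxx eseries0 ?adde0// => -[|k]//= _ _; congr EFin.
by rewrite /box_volume (bigD1 ord0)//= subrr maxxx mul0r.
Qed.

Lemma measurable_ball0 (t : R) : measurable (Defs.ball0 t : set (euclid R n)).
Proof.
rewrite /Defs.ball0 (_ : [set x | _] = setT `&` euclid_norm @^-1` `]-oo, t[).
  exact: measurable_euclid_norm.
by rewrite setTI; apply/seteqP; split => x /=; rewrite in_itv.
Qed.

(** Coordinates are bounded by the Euclidean norm, so the ball lies in the cube []-t, t]^(n+1)]. *)
Lemma lebesgue_euclid_ball0_lty (t : R) :
  lebesgue_euclid (Defs.ball0 t : set (euclid R n)) < +oo.
Proof.
have ballS : (Defs.ball0 t : set (euclid R n)) `<=`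
    box (const_mx (- t)%R, const_mx t).
  move=> x /= xt i; rewrite !mxE.
  have := le_lt_trans (le_coord_euclid_norm x i) xt.
  by rewrite ltr_norml => /andP[-> /ltW].
apply: (le_lt_trans (le_lebesgue_outer ballS)).
exact: le_lt_trans (lebesgue_outer_box _) (ltry _).
Qed.

(** Balls of integer radius exhaust the space. Tonelli's theorem and the exhaustion in the converse
    multiplier bound rest on this. *)
Lemma lebesgue_euclid_sigma_finite :
  sigma_finite setT (@lebesgue_euclid R n).
Proof.
exists (fun k => Defs.ball0 k%:R); last first.
  by move=> k; split; [exact: measurable_ball0|exact: lebesgue_euclid_ball0_lty].
apply/seteqP; split => // x _; exists (Num.bound (euclid_norm x)) => //=.
exact: archi_boundP (euclid_norm_ge0 x).
Qed.

HB.instance Definition _ := @Measure_isSigmaFinite.Build _ _ _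
  (@lebesgue_euclid R n) lebesgue_euclid_sigma_finite.

(** The conditions on [omega1] and [omega2] concern radii [t > 0] only, so the origin must be a null
    set. *)
Lemma euclid_norm_gt0_ae :
  {ae @lebesgue_euclid R n, forall x : euclid R n, (0 < euclid_norm x)%R}.
Proof.
have norm0 x : euclid_norm x = 0%R -> x = 0%R.
  move=> x0; apply/rowP => i; rewrite mxE; apply/eqP.
  by rewrite -normr_le0 -x0 le_coord_euclid_norm.
exists [set x | euclid_norm x = 0%R]; split.
- rewrite (_ : [set x | _] = setT `&` euclid_norm @^-1` [set 0%R]) ?setTI//.
  by rewrite -[X in measurable X]setTI; exact: measurable_euclid_norm.
- apply/eqP; rewrite eq_le measure_ge0 andbT.
  apply/lee_addgt0Pr => e e0; rewrite add0e.
  (* The origin lies in the box []-d, 0]^(n+1)]; the cap at 1 ensures [d^(n+1) <= d <= e]. *)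
  pose d := Num.min e 1%R.
  have d0 : (0 < d)%R by rewrite lt_min e0 ltr01.
  apply: (@le_trans _ _ (lebesgue_outer
      (box (const_mx (- d), 0)%R : set 'rV[R]_n.+1))).
    by apply: le_lebesgue_outer => x /= /norm0 -> i; rewrite !mxE lexx oppr_lt0 d0.
  apply: le_trans (lebesgue_outer_box _) _; rewrite lee_fin.
  rewrite /box_volume/=; under eq_bigr do rewrite !mxE sub0r opprK (max_l (ltW d0)).
  rewrite prodr_const card_ord exprS.
  apply: (@le_trans _ _ d); last by rewrite ge_min lexx.
  by rewrite ler_piMr ?(ltW d0)// exprn_ile1 ?(ltW d0)// ge_min lexx orbT.
- move=> x /negP; rewrite -leNgt => x0.
  by apply/eqP; rewrite eq_le x0 euclid_norm_ge0.
Qed.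

End euclidean_space.

(** * Exchanging the order of integration in a mixed norm *)

Section mixed_norm.
Context d1 d2 {T1 : measurableType d1} {T2 : measurableType d2} {R : realType}.
Variables (m1 : {sigma_finite_measure set T1 -> \bar R})
  (m2 : {sigma_finite_measure set T2 -> \bar R}).
Variables (S : set (T1 * T2)) (g : T2 -> \bar R) (w : T1 -> \bar R) (r : R).
Hypotheses (mS : measurable S) (mg : measurable_fun setT g)
  (mw : measurable_fun setT w) (r0 : (0 < r)%R).

Let F (z : T1 * T2) : \bar R := `|((fun z => g z.2 * w z.1) \_ S) z| `^ r.

Let F_ge0 z : 0 <= F z. Proof. exact: poweR_ge0. Qed.

Let measurable_F : measurable_fun setT F.
Proof.
apply: measurable_abse_poweR; apply/(measurable_restrictT _ mS).
apply: measurable_funTS; apply: emeasurable_funM.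
  by apply: (measurableT_comp mg); exact: measurable_snd.
by apply: (measurableT_comp mw); exact: measurable_fst.
Qed.

Let F_xsection t x : F (t, x) = `|(g \_ (xsection S t)) x| `^ r * `|w t| `^ r.
Proof.
rewrite /F !patchE mem_xsection; case: ifPn => _; first by rewrite /= abseM_poweR.
(* Outside [S] the restriction takes the default value [point], which is 0 in [\bar R]; its [r]-th
   power vanishes since [r] is nonzero. *)
by rewrite [`|point|]abse0 poweR0r ?gt_eqF// mul0e.
Qed.

Let F_ysection t x : F (t, x) = `|g x| `^ r * `|(w \_ (ysection S x)) t| `^ r.
Proof.
rewrite /F !patchE mem_ysection; case: ifPn => _; first by rewrite /= abseM_poweR.
by rewrite [`|point|]abse0 poweR0r ?gt_eqF// mule0.
Qed.

(** Because the inner and outer exponents agree, the outer power cancels the inner root. Both sides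
    are then [r]-th roots of iterated integrals of [F], which Tonelli's theorem identifies. *)
Lemma Lnorm_xsection_ysection :
  'N[m1]_r%:E[(fun t => 'N[m2]_r%:E[g \_ (xsection S t)] * w t)] =
  'N[m2]_r%:E[(fun x => g x * 'N[m1]_r%:E[w \_ (ysection S x)])].
Proof.
have r0' : r != 0%R by rewrite gt_eqF.
rewrite !LnormE; congr (_ `^ _).
transitivity (\int[m1]_t \int[m2]_x F (t, x)).
  apply: eq_integral => t _; rewrite abseM_poweR gee0_abs ?Lnorm_ge0// powR_Lnorm//.
  rewrite -ge0_integralZr ?poweR_ge0//; last 2 first.
  - apply: measurable_abse_poweR.
    apply/(measurable_restrictT _ (measurable_xsection t mS)).
    exact: measurable_funTS.
  - by move=> *; exact: poweR_ge0.
  by apply: eq_integral => x _; rewrite F_xsection.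
rewrite (fubini_tonelli F measurable_F F_ge0).
apply: eq_integral => x _; rewrite abseM_poweR.
rewrite [`|'N[m1]_r%:E[_]|]gee0_abs ?Lnorm_ge0// powR_Lnorm//.
rewrite -ge0_integralZl ?poweR_ge0//; last 2 first.
- apply: measurable_abse_poweR.
  apply/(measurable_restrictT _ (measurable_ysection x mS)).
  exact: measurable_funTS.
- by move=> *; exact: poweR_ge0.
by apply: eq_integral => t _; rewrite F_ysection.
Qed.

End mixed_norm.

Section measurable_section_norm.
Context d1 d2 {T1 : measurableType d1} {T2 : measurableType d2} {R : realType}.
Variable m1 : {sigma_finite_measure set T1 -> \bar R}.

(** Up to the root, this is the section integral of the function [G] on the product, measurable by
    Tonelli's theorem. *)
Lemma measurable_Lnorm_ysection (S : set (T1 * T2)) (w : T1 -> \bar R) (r : R) :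
  measurable S -> measurable_fun setT w ->
  measurable_fun setT (fun x => 'N[m1]_r%:E[w \_ (ysection S x)]).
Proof.
move=> mS mw; under eq_fun do rewrite LnormE.
apply: (measurableT_comp (measurable_poweR _)).
pose G (z : T1 * T2) : \bar R := `|((fun z => w z.1) \_ S) z| `^ r.
have mG : measurable_fun setT G.
  apply: measurable_abse_poweR; apply/(measurable_restrictT _ mS).
  apply: measurable_funTS; apply: (measurableT_comp mw).
  exact: measurable_fst.
have := measurable_fun_fubini_tonelli_G (m1 := m1) G mG (fun _ => poweR_ge0 _ _).
apply: eq_measurable_fun => x _; apply: eq_integral => t _.
by rewrite /G !patchE mem_ysection.
Qed.

End measurable_section_norm.

(** * The exponent of the multiplier norm and the upper bound for multipliers *)

Lemma exp_to_EFin {R : realType} (p q : R) : (0 < q)%R -> (q < p)%R ->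
  exp_to p%:E q%:E = ((q^-1 - p^-1)^-1)%:E.
Proof.
move=> q0 qp; have p0 : (0 < p)%R := lt_trans q0 qp.
have pq0 : (0 < q^-1 - p^-1)%R by rewrite subr_gt0 ltf_pV2.
by rewrite /exp_to lte_fin qp !inver !gt_eqF// -EFinB inver gt_eqF.
Qed.

Lemma exp_to_gt0 {R : realType} (p q : R) : (0 < q)%R -> (q <= p)%R ->
  0 < exp_to p%:E q%:E.
Proof.
move=> q0; rewrite le_eqVlt => /predU1P[->|qp]; first by rewrite /exp_to ltxx.
rewrite exp_to_EFin// lte_fin invr_gt0 subr_gt0 ltf_pV2//.
exact: lt_trans qp.
Qed.

Section multipliers.
Context d {T : measurableType d} {R : realType}.
Variable mu : {measure set T -> \bar R}.
Implicit Types (f g h : T -> R) (p q r : R).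

Local Notation "'N_ p [ f ]" := (Lnorm mu p (EFin \o f)).

Lemma Lnorm_powR p q f : (0 < p)%R -> (0 < q)%R ->
  'N_p%:E[(fun x => `|f x| `^ q)%R] = 'N_(p * q)%:E[f] `^ q.
Proof.
move=> p0 q0; have pq : ((p * q)^-1 * q = p^-1)%R.
  by rewrite invfM mulfVK// gt_eqF.
rewrite !LnormE -[RHS]poweRrM pq; apply: (f_equal (poweR^~ _)).
apply: eq_integral => x _ /=.
by rewrite ger0_norm ?powR_ge0// mulrC powRrM.
Qed.

Lemma Lnorm_if p f (E : set T) : (0 < p)%R ->
  'N_p%:E[(fun x => if x \in E then f x else 0%R)] =
  (\int[mu]_(x in E) `|(f x)%:E| `^ p) `^ p^-1.
Proof.
move=> p0; rewrite LnormE [in RHS]integral_mkcond; congr (_ `^ _).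
apply: eq_integral => x _; rewrite patchE /=; case: ifPn => // _.
by rewrite normr0 powR0// gt_eqF.
Qed.

Lemma ae_le_Lnormy (f : T -> \bar R) :
  {ae mu, forall x, `|f x| <= 'N[mu]_+oo[f]}.
Proof.
rewrite unlock; case: ifPn => [_|]; first exact: ess_sup_inf.ess_sup_ge.
(* In this case the whole space is null, so any almost-everywhere claim holds. *)
rewrite -leNgt => mu0; exists setT; split => //.
by apply/eqP; rewrite eq_le mu0 measure_ge0.
Qed.

Lemma Lnormy_le (f : T -> \bar R) (c : \bar R) : 0 <= c ->
  {ae mu, forall x, `|f x| <= c} -> 'N[mu]_+oo[f] <= c.
Proof.
by move=> c0 fc; rewrite unlock; case: ifPn => // _; apply/ess_sup_inf.ess_supP.
Qed.

Lemma measurable_normr_powR f r : measurable_fun setT f ->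
  measurable_fun setT (fun x => `|f x| `^ r)%R.
Proof.
move=> mf; apply: (measurableT_comp (measurable_powR _)).
exact: measurableT_comp.
Qed.

(* For [q < p] this is Hoelder's inequality with exponents p/q and r/q, applied
   to |f|^q and |h|^q. *)
Lemma Lnorm_mul_le p q f h : (0 < q)%R -> (q <= p)%R ->
  measurable_fun setT f -> measurable_fun setT h ->
  Lnorm mu (exp_to p%:E q%:E) (EFin \o h) < +oo ->
  'N_q%:E[(f \* h)%R] <=
    Lnorm mu (exp_to p%:E q%:E) (EFin \o h) * 'N_p%:E[f].
Proof.
move=> q0; rewrite le_eqVlt => /predU1P[<-|qp] mf mh.
  (* For [p = q] the exponent is [+oo], and [|h| <= M] almost everywhere gives
     [|f h|^q <= M^q |f|^q]. *)
  rewrite /exp_to ltxx => hoo.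
  set M := Lnorm _ _ _ in hoo *.
  have M0 : 0 <= M by exact: Lnorm_ge0.
  have Mfin : M \is a fin_num by rewrite ge0_fin_numE.
  have mf' : measurable_fun setT (EFin \o f) by exact/measurable_EFinP.
  rewrite !LnormE -[X in X * _](@poweRK _ q)// -poweRM ?poweR_ge0//; last first.
    by apply: integral_ge0 => *; exact: poweR_ge0.
  rewrite lee_poweR2r ?invr_ge0 ?(ltW q0)//.
    by apply: integral_ge0 => *; exact: poweR_ge0.
  rewrite -ge0_integralZl ?poweR_ge0//; last 2 first.
  - exact: measurable_abse_poweR.
  - by move=> *; exact: poweR_ge0.
  apply: ae_ge0_le_integral => //.
  - by move=> *; exact: poweR_ge0.
  - apply: measurable_abse_poweR; apply/measurable_EFinP.
    exact: measurable_funM.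
  - by move=> *; rewrite mule_ge0 ?poweR_ge0.
  - by apply: emeasurable_funM => //; exact: measurable_abse_poweR.
  have := ae_le_Lnormy (EFin \o h).
  apply: filterS => x /= hM _.
  rewrite normrM powRM// EFinM muleC.
  rewrite lee_wpmul2r ?lee_fin ?powR_ge0//.
  rewrite -poweR_EFin lee_poweR2r// ltW//.
have p0 : (0 < p)%R := lt_trans q0 qp.
have pq0 : (0 < q^-1 - p^-1)%R by rewrite subr_gt0 ltf_pV2.
rewrite exp_to_EFin//; set r := (_^-1)%R => _.
have r0 : (0 < r)%R by rewrite invr_gt0.
have := @hoelder _ _ _ mu (fun x => `|f x| `^ q)%R (fun x => `|h x| `^ q)%R
  (p / q) (r / q) (measurable_normr_powR _ mf) (measurable_normr_powR _ mh).
rewrite !divr_gt0// => /(_ isT isT).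
(* The exponents are conjugate: [q/p + q/r = q (1/p + 1/q - 1/p) = 1]. *)
have -> : ((p / q)^-1 + (r / q)^-1 = 1)%R.
  by rewrite !invf_div /r invrK -mulrDr addrCA subrr addr0 mulfV// gt_eqF.
move=> /(_ erefl).
rewrite !Lnorm_powR ?divr_gt0// !divfK ?gt_eqF//.
rewrite Lnorm1 => H.
rewrite -(@lee_poweR2rE _ q) ?mule_ge0 ?Lnorm_ge0//.
rewrite powR_Lnorm ?gt_eqF// poweRM ?Lnorm_ge0// [leRHS]muleC.
apply: le_trans H; rewrite le_eqVlt; apply/orP; left; apply/eqP.
apply: eq_integral => x _ /=.
by rewrite normrM powRM// [in RHS]ger0_norm// mulr_ge0 ?powR_ge0.
Qed.

End multipliers.

(** * Sharpness of the multiplier bound *)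

Section multiplier_converse.
Context d {T : measurableType d} {R : realType}.
Variable mu : {sigma_finite_measure set T -> \bar R}.
Variables (p q c : R) (h : T -> R).
Hypotheses (q0 : (0 < q)%R) (c0 : (0 <= c)%R) (mh : measurable_fun setT h).

Local Notation "'N_ p [ f ]" := (Lnorm mu p (EFin \o f)).

Hypothesis hc : forall g : T -> R, measurable_fun setT g ->
  'N_p%:E[g] < +oo -> 'N_q%:E[(g \* h)%R] <= c%:E * 'N_p%:E[g].

Let exhaust : exists A : nat -> set T,
  [/\ setT = \bigcup_k A k, {homo A : k l / (k <= l)%N >-> (k <= l)%O},
    forall k, measurable (A k) & forall k, mu (A k) < +oo].
Proof.
have [A [AT ndA A_]] := (sigma_finiteP setT mu).1 (sigma_finiteT mu).
by exists A; split => // k; have [] := A_ k.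
Qed.

Let measurable_le_abs (a : R) : measurable [set x | (`|h x| <= a)%R].
Proof.
rewrite (_ : [set x | _] = setT `&` (fun x => `|h x|)%R @^-1` `]-oo, a]).
  by apply: (measurableT_comp _ mh).
by rewrite setTI; apply/seteqP; split => x /=; rewrite in_itv.
Qed.

Let measurable_if (f : T -> R) (E : set T) : measurable_fun setT f ->
  measurable E -> measurable_fun setT (fun x => if x \in E then f x else 0%R).
Proof.
move=> mf mE.
apply: measurable_fun_ifT => //.
apply: (measurable_fun_bool true).
rewrite setTI (_ : _ @^-1` _ = E)//; apply/seteqP.
by split => x /=; [exact: set_mem|exact: mem_set].
Qed.

(* The truncation to E_k, where |h| <= k, makes the test functions p-integrable
   and lets the finite quantity I^(1/p) be cancelled. *)
Lemma Lnorm_multiplier_converse : (q <= p)%R ->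
  Lnorm mu (exp_to p%:E q%:E) (EFin \o h) <= c%:E.
Proof.
have [A [AT ndA mA Aoo]] := exhaust.
rewrite le_eqVlt => /predU1P[qp|qp].
  rewrite -{1}qp /exp_to ltxx; apply: Lnormy_le; first by rewrite lee_fin.
  (* These sets of finite measure exhaust the set where [|h| > c], so it suffices that each is null;
     their indicators are the test functions. *)
  pose E k := A k `&` ~` [set x | (`|h x| <= c)%R].
  have mE k : measurable (E k) by apply: measurableI => //; exact: measurableC.
  have Eoo k : mu (E k) < +oo.
    by apply: le_lt_trans (Aoo k); rewrite le_measure ?inE//; apply: subIsetl.
  suff E0 k : mu (E k) = 0.
    have : mu.-negligible (\bigcup_k E k).
      apply: negligible_bigcup => k; exists (E k); split => //; exact: E0.
    apply: negligibleS => x /= hx.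
    by have [k _ Akx] : (\bigcup_k A k) x by [rewrite -AT]; exists k.
  have m1 : measurable_fun [set: T] (fun _ => 1%R : R) by exact: measurable_cst.
  have N1 : 'N_q%:E[(fun x => if x \in E k then 1%R else 0%R)] =
      mu (E k) `^ q^-1.
    rewrite Lnorm_if//; apply: (f_equal (poweR^~ _)).
    under eq_integral do rewrite /= normr1 powR1.
    by rewrite -[RHS]mul1e -integral_cst.
  have := hc (measurable_if m1 (mE k)).
  rewrite -{1 2}qp N1 => /(_ (poweR_lty _ (Eoo k))).
  have -> : 'N_q%:E[((fun x => if x \in E k then 1 else 0) \* h)%R] =
      (\int[mu]_(x in E k) `|(h x)%:E| `^ q) `^ q^-1.
    rewrite -Lnorm_if//; apply: eq_Lnorm => x /=.
    by case: ifPn; rewrite ?mul1r ?mul0r.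
  move=> /(lee_poweR2r (ltW q0) (poweR_ge0 _ _)).
  rewrite poweRM ?lee_fin ?poweR_ge0// !poweRVK//; last first.
    by apply: integral_ge0 => *; exact: poweR_ge0.
  (* The test inequality bounds the integral of [|h|^q] over [E k] by [c^q mu (E k)]. This quantity
     is finite and can be subtracted, so [D], positive on [E k], has integral at most 0 there and
     [E k] is null. *)
  pose D x : \bar R := (`|h x| `^ q - c `^ q)%:E.
  have D0 x : E k x -> 0 < D x.
    move=> [_ /negP]; rewrite -ltNge => cx.
    by rewrite lte_fin subr_gt0 gt0_ltr_powR ?nnegrE.
  have mD : measurable_fun (E k) D.
    apply: measurable_funTS; apply/measurable_EFinP; apply: measurable_funB => //.
    exact: measurable_normr_powR.
  have cfin : c%:E `^ q * mu (E k) \is a fin_num by rewrite fin_numM// ge0_fin_numE.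
  have -> : \int[mu]_(x in E k) `|(h x)%:E| `^ q =
      \int[mu]_(x in E k) D x + c%:E `^ q * mu (E k).
    rewrite -integral_cst// -ge0_integralD//.
    - by apply: eq_integral => x _; rewrite /D /= -EFinD subrK.
    - by move=> x /D0/ltW.
    - by move=> *; exact: poweR_ge0.
  rewrite -leeBrDr// subee// => Dle0.
  have : \int[mu]_(x in E k) `|D x| = 0.
    apply/eqP; rewrite eq_le integral_ge0// andbT; apply: le_trans Dle0.
    rewrite le_eqVlt; apply/orP; left; apply/eqP; apply: eq_integral => x.
    by rewrite inE => /D0/ltW/gee0_abs.
  move=> /(ae_eq_integral_abs _ (mE k) mD) Dz.
  apply: (measure_negligible (mE k)); apply: negligibleS Dz => x Ex /=.
  by move=> /(_ Ex) Dx; have := D0 _ Ex; rewrite Dx ltxx.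
have p0 : (0 < p)%R := lt_trans q0 qp.
have pq0 : (0 < q^-1 - p^-1)%R by rewrite subr_gt0 ltf_pV2.
rewrite exp_to_EFin//; set r := (_^-1)%R.
have r0 : (0 < r)%R by rewrite invr_gt0.
pose f x := (`|(h x)%:E| `^ r).
have f0 x : 0 <= f x by exact: poweR_ge0.
have mf : measurable_fun setT f.
  by apply: measurable_abse_poweR; exact/measurable_EFinP.
have qrp : (q^-1 = r^-1 + p^-1)%R by rewrite /r invrK subrK.
have rpq : (r / p + 1 = r / q)%R by rewrite qrp mulrDr mulfV ?gt_eqF// addrC.
suff fc : \int[mu]_x f x <= c%:E `^ r.
  rewrite LnormE -[leRHS](@poweRK _ r)// lee_poweR2r//.
    by rewrite invr_ge0 ltW.
  by apply: integral_ge0 => x _; exact: f0.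
pose E k := A k `&` [set x | (`|h x| <= k%:R)%R].
have mE k : measurable (E k) by apply: measurableI.
have Eoo k : mu (E k) < +oo.
  by apply: le_lt_trans (Aoo k); rewrite le_measure ?inE//; apply: subIsetl.
have ndE : {homo E : k l / (k <= l)%N >-> (k <= l)%O}.
  move=> k l kl; apply/subsetPset => x [Akx hk]; split.
    by have /subsetPset := ndA _ _ kl; exact.
  by apply: le_trans hk _; rewrite ler_nat.
have ET : \bigcup_k E k = setT.
  apply/seteqP; split => // x _.
  have [k _ Akx] : (\bigcup_k A k) x by rewrite -AT.
  pose l := maxn k (Num.bound `|h x|%R).
  exists l => //; split.
    by have /subsetPset := ndA _ _ (leq_maxl k (Num.bound `|h x|%R)); exact.
  apply/ltW/(lt_le_trans (archi_boundP _)) => //.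
  by rewrite ler_nat leq_maxr.
have fE k : \int[mu]_(x in E k) f x <= c%:E `^ r.
  set I := \int[mu]_(x in _) _.
  have I0 : 0 <= I by exact: integral_ge0.
  have Ioo : I < +oo.
    apply: (@le_lt_trans _ _ (\int[mu]_(x in E k) cst (k%:R `^ r)%:E x)).
      apply: ge0_le_integral => //; first exact: measurable_funTS.
      by move=> x [_ hk]; rewrite /f /= lee_fin ge0_ler_powR ?nnegrE ?(ltW r0)//.
    rewrite integral_cst// lte_mul_pinfty ?lee_fin ?powR_ge0//. 
    exact: Eoo.
  (* On [E k] this choice gives [|g|^p = |h|^r], and also [|g h|^q = |h|^r] because [r/p + 1 = r/q].
     Both norms are thus powers of the same integral [I]. *)
  pose g x := if x \in E k then (`|h x| `^ (r / p))%R else 0%R.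
  have mg : measurable_fun setT g.
    by apply: measurable_if => //; exact: measurable_normr_powR.
  have gI : 'N_p%:E[g] = I `^ p^-1.
    rewrite (Lnorm_if mu _ _ p0); apply: (f_equal (poweR^~ _)).
    apply: eq_integral => x _.
    by rewrite /f /= ger0_norm ?powR_ge0// -powRrM divfK// gt_eqF.
  have ghI : 'N_q%:E[(g \* h)%R] = I `^ q^-1.
    transitivity 'N_q%:E[(fun x => if x \in E k then
        (`|h x| `^ (r / p) * h x)%R else 0%R)].
      by apply: eq_Lnorm => x /=; rewrite /g; case: ifPn => //; rewrite mul0r.
    rewrite (Lnorm_if mu _ _ q0); apply: (f_equal (poweR^~ _)).
    apply: eq_integral => x _.
    rewrite /f /= normrM ger0_norm ?powR_ge0//.
    (* At zeros of [h] both sides are 0; elsewhere the base is nonzero and exponents add. *)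
    have [->|hx] := eqVneq (h x) 0%R.
      by rewrite normr0 mulr0 !powR0 ?gt_eqF.
    rewrite -{2}(@powRr1 _ `|h x|%R)// -powRD; last first.
      by rewrite normr_eq0 hx implybT.
    rewrite -powRrM; congr (_ `^ _)%:E.
    by rewrite rpq divfK// gt_eqF.
  have := hc mg; rewrite gI ghI => /(_ (poweR_lty _ Ioo)) H.
  have [Iz|In0] := eqVneq I 0; first by rewrite Iz poweR_ge0.
  have Ifin : I \is a fin_num by rewrite ge0_fin_numE.
  (* The inequality reads [I^(1/r) I^(1/p) <= c I^(1/p)] with [0 < I < +oo]; cancelling leaves
     [I^(1/r) <= c]. *)
  move: H; rewrite qrp poweRD; last first.
    by apply: add_neq0_poweRD_def; rewrite -qrp invr_neq0// gt_eqF.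
  rewrite lee_pmul2r; last 2 first.
  - by rewrite fin_num_poweR.
  - by rewrite poweR_gt0// lt_neqAle eq_sym In0.
  move=> /(lee_poweR2r (ltW r0) (poweR_ge0 _ _)).
  by rewrite poweRVK.
(* Monotone convergence along the sets [E k] carries the uniform bound over to the whole space. *)
have := ge0_nondecreasing_set_cvg_integral (mu := mu) (f := f) ndE mE
  (fun k => measurable_funTS mf) (fun k x _ => f0 x).
rewrite ET => fcvg.
rewrite -(cvg_lim _ fcvg)//; apply: lime_le.
  by apply/cvg_ex; eexists; exact: fcvg.
by near=> k; exact: fE.
Unshelve. all: by end_near.
Qed.
End multiplier_converse.

(** * The Morrey-type norms as weighted Lebesgue norms *)

Section radial_weights.
Context {R : realType}.

Local Notation lambda := (@completed_lebesgue_measure R).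

Lemma measurable_line_id : measurable_fun setT (fun t : line R => t : R).
Proof.
by move=> _ Y mY; rewrite setTI; exact: sub_caratheodory.
Qed.

Lemma measurable_line (A : set R) : measurable A -> measurable (A : set (line R)).
Proof. exact: sub_caratheodory. Qed.

Lemma completed_lebesgue_measure_set1 (a : R) : lambda [set a] = 0.
Proof. exact: lebesgue_measure_set1. Qed.

Context {n : nat}.
Implicit Types (p : R) (omega : line R -> \bar R) (v f : euclid R n -> \bar R).

Lemma measurable_le_norm :
  measurable [set z : line R * euclid R n | (z.1 <= euclid_norm z.2)%R].
Proof.
rewrite (_ : [set _ | _] = setT `&` (fun z : line R * euclid R n =>
   ((z.1 : R) <= euclid_norm z.2)%R) @^-1` [set true]); last by rewrite setTI.
apply: measurable_fun_ler => //.
  by apply: (measurableT_comp measurable_line_id); exact: measurable_fst.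
by apply: (measurableT_comp measurable_euclid_norm); exact: measurable_snd.
Qed.

Definition inner_weight p omega (x : euclid R n) : \bar R :=
  norm_on lambda p%:E `]0%R, euclid_norm x[ omega.

Definition outer_weight p omega (x : euclid R n) : \bar R :=
  norm_on lambda p%:E `]euclid_norm x, +oo[ omega.

(** The slice of [S] at [t] is the complement of [ball0 t], and its slice at [x] is the half-line up
    to [|x|]; the complement of [S] yields [ball0 t] and []|x|, +oo[]. One set thus serves both
    norms. *)
Let S : set (line R * euclid R n) :=
  [set z : line R * euclid R n | (z.1 <= euclid_norm z.2)%R].

Let mS : measurable S := measurable_le_norm.
Let mSC : measurable (~` S) := measurableC mS.

(** This restricts the argument to [t > 0], not the values: [omega] is measurable only on the
    half-line, while Tonelli's theorem is applied on the whole line. *)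
Let pos_part omega : line R -> \bar R := omega \_ `]0%R, +oo[.

Let measurable_pos_part omega :
  nonneg_measurable (T := line R) `]0%R, +oo[ omega ->
  measurable_fun setT (pos_part omega).
Proof.
move=> [momega _].
exact/(measurable_restrictT _ (measurable_line (measurable_itv `]0%R, +oo[))).
Qed.

(** The slice of [S] contains the endpoint [t = |x|] and the open interval does not; a single point
    is null. *)
Let inner_weightE p omega x : (0 < p)%R ->
  nonneg_measurable (T := line R) `]0%R, +oo[ omega ->
  inner_weight p omega x = 'N[lambda]_p%:E[pos_part omega \_ (ysection S x)].
Proof.
move=> p0 homega; apply: eq_Lnorm_ae; first by rewrite lte_fin.
- apply/(measurable_restrictT _ (measurable_line (measurable_itv _))).
  case: homega => momega _; apply: measurable_funS momega.
    exact: measurable_line (measurable_itv _).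
  by move=> t /=; rewrite !in_itv/= andbT => /andP[].
- apply/(measurable_restrictT _ (measurable_ysection x mS)).
  by apply: measurable_funTS; exact: measurable_pos_part.
exists [set euclid_norm x]; split.
- exact: measurable_line.
- exact: completed_lebesgue_measure_set1.
move=> t /= h; apply: contrapT => /eqP tx; apply: h.
rewrite /pos_part !patchE mem_ysection.
have -> : ((t, x) \in S) = ((t : R) <= euclid_norm x)%R.
  by apply/idP/idP => [/set_mem//|?]; exact: mem_set.
rewrite !mem_setE /= !in_itv/= andbT le_eqVlt (negbTE tx)/=.
by case: ltP => _; case: ltP.
Qed.

Let outer_weightE p omega x :
  outer_weight p omega x = 'N[lambda]_p%:E[pos_part omega \_ (ysection (~` S) x)].
Proof.
congr Lnorm; apply/funext => t; rewrite /pos_part !patchE mem_ysection.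
have -> : ((t, x) \in ~` S) = (euclid_norm x < (t : R))%R.
  apply/idP/idP => [/set_mem/= /negP|tx]; first by rewrite -ltNge.
  by apply: mem_set => /=; apply/negP; rewrite -ltNge.
rewrite !mem_setE /= !in_itv/= !andbT.
case: ltP => // tx; case: ltP => //.
by rewrite leNgt (le_lt_trans (euclid_norm_ge0 x)).
Qed.

Lemma measurable_inner_weight p omega : (0 < p)%R ->
  nonneg_measurable (T := line R) `]0%R, +oo[ omega ->
  measurable_fun setT (inner_weight p omega).
Proof.
move=> p0 homega; rewrite (funext (fun x => inner_weightE x p0 homega)).
exact: (measurable_Lnorm_ysection _ p mS (measurable_pos_part homega)).
Qed.

Lemma measurable_outer_weight p omega :
  nonneg_measurable (T := line R) `]0%R, +oo[ omega ->
  measurable_fun setT (outer_weight p omega).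
Proof.
move=> homega; rewrite (funext (outer_weightE p omega)).
exact: (measurable_Lnorm_ysection _ p mSC (measurable_pos_part homega)).
Qed.

(** This is the exchange of norms over [S], with [f v] in the space variable and the cut-off [omega]
    in the radius. *)
Lemma cLM_normE p omega v f : (0 < p)%R ->
  nonneg_measurable (T := line R) `]0%R, +oo[ omega ->
  measurable_fun setT v -> measurable_fun setT f ->
  cLM_norm p%:E p%:E omega v f =
  'N[lebesgue_euclid]_p%:E[(fun x => f x * v x * inner_weight p omega x)].
Proof.
move=> p0 homega mv mf.
transitivity ('N[lebesgue_euclid]_p%:E[(fun x => (f x * v x) *
    'N[lambda]_p%:E[pos_part omega \_ (ysection S x)])]); last first.
  by apply: eq_Lnorm => x; rewrite inner_weightE.
have mfv : measurable_fun setT (fun x => f x * v x) by exact: emeasurable_funM.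
rewrite -(Lnorm_xsection_ysection _ _ mS mfv (measurable_pos_part homega) p0).
apply: eq_Lnorm => t; rewrite /pos_part !patchE.
case: ifPn => _; last by rewrite mule0.
congr (_ * _); congr Lnorm; congr patch.
apply/seteqP; split => x /=; rewrite /ball0/= /xsection/=.
  by move=> /negP; rewrite -leNgt => tx; apply: mem_set.
by move=> /set_mem/= tx; apply/negP; rewrite -leNgt.
Qed.

Lemma LM_normE p omega v f : (0 < p)%R ->
  nonneg_measurable (T := line R) `]0%R, +oo[ omega ->
  measurable_fun setT v -> measurable_fun setT f ->
  LM_norm p%:E p%:E omega v f =
  'N[lebesgue_euclid]_p%:E[(fun x => f x * v x * outer_weight p omega x)].
Proof.
move=> p0 homega mv mf.
transitivity ('N[lebesgue_euclid]_p%:E[(fun x => (f x * v x) *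
    'N[lambda]_p%:E[pos_part omega \_ (ysection (~` S) x)])]); last first.
  by apply: eq_Lnorm => x; rewrite outer_weightE.
have mfv : measurable_fun setT (fun x => f x * v x) by exact: emeasurable_funM.
rewrite -(Lnorm_xsection_ysection _ _ mSC mfv (measurable_pos_part homega) p0).
apply: eq_Lnorm => t; rewrite /pos_part !patchE.
case: ifPn => _; last by rewrite mule0.
congr (_ * _); congr Lnorm; congr patch.
apply/seteqP; split => x /=; rewrite /xsection/=.
  by move=> tx; apply: mem_set => /=; apply/negP; rewrite -ltNge.
by move=> /set_mem/= /negP; rewrite -ltNge.
Qed.

End radial_weights.

(** * The optimal constant between two weighted Lebesgue norms *)

Section multiplier_norm.
Context d {T : measurableType d} {R : realType}.
Variable mu : {sigma_finite_measure set T -> \bar R}.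
Variables (p q : R) (u1 u2 : T -> \bar R).
Hypotheses (q0 : (0 < q)%R) (qp : (q <= p)%R).
Hypotheses (mu1 : measurable_fun setT u1) (mu2 : measurable_fun setT u2).
Hypotheses (u1P : {ae mu, forall x, 0 < u1 x < +oo})
  (u2P : {ae mu, forall x, 0 < u2 x < +oo}).

Let p0 : (0 < p)%R := lt_le_trans q0 qp.

(** A real-valued representative of [u2 / u1], equal to it wherever both weights are positive and
    finite, so that the bounds for real functions apply. *)
Let h x : R := ((fine (u1 x))^-1 * fine (u2 x))%R.

Let measurable_fine_comp (u : T -> \bar R) : measurable_fun setT u ->
  measurable_fun setT (fun x => fine (u x)).
Proof. by move=> mu_; apply: (measurableT_comp (@measurable_fine R)). Qed.

Let measurable_h : measurable_fun setT h.
Proof.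
apply: measurable_funM; last exact: measurable_fine_comp.
apply: (measurableT_comp (@measurable_invr R)).
exact: measurable_fine_comp.
Qed.

Let fineP (u : \bar R) : 0 < u < +oo -> exists2 a : R, (0 < a)%R & u = a%:E.
Proof. by case: u => [a||] //; rewrite ?ltxx ?andbF// => /andP[a0 _]; exists a. Qed.

Definition multiplier_norm :=
  'N[mu]_(exp_to p%:E q%:E)[(fun x => (u1 x)^-1 * u2 x)].

Let multiplier_normE :
  multiplier_norm = 'N[mu]_(exp_to p%:E q%:E)[EFin \o h].
Proof.
apply: eq_Lnorm_ae; first exact: exp_to_gt0.
- exact: (emeasurable_funM (measurableT_comp (@measurable_inve R) mu1) mu2).
- exact/measurable_EFinP.
apply: filterS2 u1P u2P => x /fineP[a a0 u1a] /fineP[b b0 u2b].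
by rewrite /h /= u1a u2b inver gt_eqF.
Qed.

Lemma Lnorm_fin_ae (r : R) (F : T -> \bar R) : (0 < r)%R ->
  measurable_fun setT F -> 'N[mu]_r%:E[F] < +oo ->
  {ae mu, forall x, F x \is a fin_num}.
Proof.
move=> r0 mF; rewrite Lnorm_lty// => Foo.
have : mu.-integrable setT (fun x => `|F x| `^ r).
  apply/integrableP; split; first exact: measurable_abse_poweR.
  by under eq_integral do rewrite gee0_abs ?poweR_ge0//.
move=> /(integrable_ae measurableT); apply: filterS => x /(_ I).
rewrite ge0_fin_numE ?poweR_ge0// => /lty_poweRy.
by rewrite gt_eqF// => /(_ isT); rewrite -ge0_fin_numE// abse_fin_num.
Qed.

Lemma Lnorm_multiplier_le (F : T -> \bar R) : measurable_fun setT F ->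
  multiplier_norm < +oo -> 'N[mu]_p%:E[(fun x => F x * u1 x)] < +oo ->
  'N[mu]_q%:E[(fun x => F x * u2 x)] <=
    multiplier_norm * 'N[mu]_p%:E[(fun x => F x * u1 x)].
Proof.
rewrite multiplier_normE => mF hoo Foo.
have mFu1 : measurable_fun setT (fun x => F x * u1 x) by exact: emeasurable_funM.
have mFu2 : measurable_fun setT (fun x => F x * u2 x) by exact: emeasurable_funM.
pose g x := fine (F x * u1 x).
have mg : measurable_fun setT g by exact: measurable_fine_comp.
have finF := Lnorm_fin_ae p0 mFu1 Foo.
have -> : 'N[mu]_p%:E[(fun x => F x * u1 x)] = 'N[mu]_p%:E[EFin \o g].
  apply: eq_Lnorm_ae; [by rewrite lte_fin|exact: mFu1|exact/measurable_EFinP|].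
  by apply: filterS finF => x fx; rewrite /= /g fineK.
have -> : 'N[mu]_q%:E[(fun x => F x * u2 x)] = 'N[mu]_q%:E[EFin \o (g \* h)%R].
  apply: eq_Lnorm_ae; [by rewrite lte_fin|exact: mFu2| |].
    by apply/measurable_EFinP; exact: measurable_funM.
  apply: filterS3 finF u1P u2P => x fx /fineP[a a0 u1a] /fineP[b b0 u2b].
  move: fx; rewrite /= /g /h u1a u2b /=.
  (* Since [u1 x] is positive and finite, finiteness of [F x * u1 x] rules out infinite values of
     [F x]. *)
  case: (F x) => [s||]; rewrite ?gt0_mulye ?gt0_mulNye ?lte_fin// => _.
  by rewrite -!EFinM /= mulrA mulfK// gt_eqF.
exact: Lnorm_mul_le.
Qed.

Lemma multiplier_norm_le (c : R) : (0 <= c)%R ->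
  (forall F : T -> \bar R, measurable_fun setT F ->
    'N[mu]_p%:E[(fun x => F x * u1 x)] < +oo ->
    'N[mu]_q%:E[(fun x => F x * u2 x)] <=
      c%:E * 'N[mu]_p%:E[(fun x => F x * u1 x)]) ->
  multiplier_norm <= c%:E.
Proof.
move=> c0 hF; rewrite multiplier_normE.
apply: Lnorm_multiplier_converse => // g mg goo.
(* Dividing by [u1] makes the weighted norms of [F] equal to the norms of [g] and [g h]. *)
pose F x := (g x / fine (u1 x))%:E.
have mF : measurable_fun setT F.
  apply/measurable_EFinP; apply: measurable_funM => //.
  apply: (measurableT_comp (@measurable_invr R)).
  exact: measurable_fine_comp.
have gE : 'N[mu]_p%:E[EFin \o g] = 'N[mu]_p%:E[(fun x => F x * u1 x)].
  apply: eq_Lnorm_ae; [by rewrite lte_fin|exact/measurable_EFinP| |].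
    exact: emeasurable_funM.
  apply: filterS u1P => x /fineP[a a0 u1a].
  by rewrite /F u1a /= -EFinM divfK// gt_eqF.
have ghE : 'N[mu]_q%:E[EFin \o (g \* h)%R] = 'N[mu]_q%:E[(fun x => F x * u2 x)].
  apply: eq_Lnorm_ae; [by rewrite lte_fin| | |].
  - by apply/measurable_EFinP; exact: measurable_funM.
  - exact: emeasurable_funM.
  apply: filterS2 u1P u2P => x /fineP[a a0 u1a] /fineP[b b0 u2b].
  by rewrite /F /h /= u1a u2b -EFinM mulrA.
by rewrite ghE gE; apply: hF => //; rewrite -gE.
Qed.

End multiplier_norm.

(** * The embedding constant *)

Section embedding.
Context {R : realType} {n : nat}.
Implicit Types (p q : R) (omega : line R -> \bar R) (v f : euclid R n -> \bar R).

Local Notation lambda := (@completed_lebesgue_measure R).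
Local Notation mu := (@lebesgue_euclid R n).

Lemma le_inner_weight p omega (t : R) (x : euclid R n) : (0 < p)%R ->
  (t <= euclid_norm x)%R ->
  norm_on lambda p%:E `]0%R, t[ omega <= inner_weight p omega x.
Proof.
move=> p0 tx; apply: le_Lnorm => // s; rewrite !patchE !mem_setE/= !in_itv/=.
case: ifPn => [/andP[-> st]|_]; last by rewrite abse0 abse_ge0.
by rewrite (lt_le_trans st tx).
Qed.

Lemma le_outer_weight p omega (t : R) (x : euclid R n) : (0 < p)%R ->
  (euclid_norm x <= t)%R ->
  norm_on lambda p%:E `]t, +oo[ omega <= outer_weight p omega x.
Proof.
move=> p0 tx; apply: le_Lnorm => // s; rewrite !patchE !mem_setE/= !in_itv/= !andbT.
case: ifPn => [st|_]; last by rewrite abse0 abse_ge0.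
by rewrite (le_lt_trans tx st).
Qed.

Lemma compact_sub_ball0 (K : set 'rV[R]_n.+1) : compact K ->
  exists2 t : R, (0 < t)%R & K `<=` [set x | (euclid_norm x <= t)%R].
Proof.
move=> /compact_bounded[M [_ KM]].
(* The sup-norm bound is available for reals strictly above [M]; this one is also positive. *)
pose N := (`|M| + 1)%R.
have N0 : (0 < N)%R by rewrite ltr_wpDl.
exists (Num.sqrt (\sum_(i < n.+1) N ^+ 2)).
  by rewrite sqrtr_gt0 sumr_const card_ord pmulrn_lgt0// exprn_gt0.
move=> x /KM xN.
have {}xN : (`|x| <= N)%R by apply: xN; rewrite (le_lt_trans (ler_norm M))// ltrDl.
rewrite /= ler_sqrt; last by apply: sumr_ge0 => i _; exact: sqr_ge0.
apply: ler_sum => i _; rewrite -[X in (X <= _)%R]real_normK ?num_real//.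
rewrite lerXn2r ?nnegrE ?(ltW N0)//; apply: le_trans xN.
by rewrite -[leRHS]/(mx_norm x) mx_normrE (le_bigmax _ _ (ord0, i)).
Qed.

Lemma pos_lt_inner_weight p omega : cOmega p%:E omega ->
  {ae mu, forall x, 0 < inner_weight p omega x < +oo}.
Proof.
move=> [_ homega]; apply: filterS euclid_norm_gt0_ae => x x0.
exact: homega.
Qed.

Lemma pos_lt_outer_weight p omega : Omega p%:E omega ->
  {ae mu, forall x, 0 < outer_weight p omega x < +oo}.
Proof.
move=> [_ homega]; apply: filterS euclid_norm_gt0_ae => x x0.
exact: homega.
Qed.

(* The other conditions defining [cLM] and [LM] are automatic, since the radial
   weights are bounded below away from 0, resp. on bounded sets. *)
Lemma cLMP p omega v f : (0 < p)%R -> cOmega p%:E omega ->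
  measurable_fun setT v ->
  cLM p%:E p%:E omega v f <-> measurable_fun setT f /\
    'N[mu]_p%:E[(fun x => f x * v x * inner_weight p omega x)] < +oo.
Proof.
move=> p0 [momega homega] mv; split=> [[mf _]|[mf fy]]; first by rewrite cLM_normE.
split=> //; last by rewrite cLM_normE.
move=> t t0; have /andP[c0 cy] := homega t t0.
apply: (@Lnorm_patch_lty _ _ _ _ _ _ _ (inner_weight p omega)
  (fine (norm_on lambda p%:E `]0%R, t[ omega))) fy.
- exact: p0.
- apply: emeasurable_funM; first exact: emeasurable_funM.
  exact: measurable_inner_weight.
- by rewrite fine_gt0// c0.
- move=> x /negP; rewrite -leNgt => tx.
  by rewrite fineK ?le_inner_weight// ge0_fin_numE// ltW.
Qed.

Lemma LMP p omega v f : (0 < p)%R -> Omega p%:E omega ->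
  measurable_fun setT v ->
  LM p%:E p%:E omega v f <-> measurable_fun setT f /\
    'N[mu]_p%:E[(fun x => f x * v x * outer_weight p omega x)] < +oo.
Proof.
move=> p0 [momega homega] mv.
split=> [[[mf _]]|[mf fy]]; first by rewrite LM_normE.
split; last by rewrite LM_normE.
split=> // K /compact_sub_ball0[t t0 Kt]; have /andP[c0 cy] := homega t t0.
apply: (@Lnorm_patch_lty _ _ _ _ _ _ _ (outer_weight p omega)
  (fine (norm_on lambda p%:E `]t, +oo[ omega))) fy.
- exact: p0.
- apply: emeasurable_funM; first exact: emeasurable_funM.
  exact: measurable_outer_weight.
- by rewrite fine_gt0// c0.
- move=> x /Kt tx.
  by rewrite fineK ?le_outer_weight// ge0_fin_numE// ltW.
Qed.

Lemma pos_lt_mule (x y : \bar R) : 0 < x < +oo -> 0 < y < +oo ->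
  0 < x * y < +oo.
Proof.
move=> /andP[x0 xy] /andP[y0 yy]; rewrite mule_gt0//=.
by rewrite lte_mul_pinfty ?ge0_fin_numE ?ltW.
Qed.

(** With [u1 = v1 W1] and [u2 = v2 W2], membership in either space means measurability and a finite
    weighted norm. The admissible constants are therefore those of the multiplier problem. *)
Lemma embedding_norm_cLM_LM p q (v1 v2 : euclid R n -> \bar R)
    (omega1 omega2 : line R -> \bar R) : (0 < q)%R -> (q <= p)%R ->
  weight mu setT v1 -> weight mu setT v2 ->
  cOmega p%:E omega1 -> Omega q%:E omega2 ->
  embedding_norm
    (cLM p%:E p%:E omega1 v1) (cLM_norm p%:E p%:E omega1 v1)
    (LM q%:E q%:E omega2 v2) (LM_norm q%:E q%:E omega2 v2) =
  wnorm_on mu (exp_to p%:E q%:E) (fun x => (v1 x)^-1 * v2 x) setT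
    (fun x => (inner_weight p omega1 x)^-1 * outer_weight q omega2 x).
Proof.
move=> q0 qp [mv1 v1P] [mv2 v2P] homega1 homega2.
have p0 : (0 < p)%R := lt_le_trans q0 qp.
have [nomega1 _] := homega1; have [nomega2 _] := homega2.
have W1P := pos_lt_inner_weight homega1.
have W2P := pos_lt_outer_weight homega2.
have mW1 : measurable_fun setT (@inner_weight R n p omega1).
  exact: measurable_inner_weight.
have mW2 : measurable_fun setT (@outer_weight R n q omega2).
  exact: measurable_outer_weight.
have {}v1P : {ae mu, forall x, 0 < v1 x < +oo} by apply: filterS v1P => x; exact.
have {}v2P : {ae mu, forall x, 0 < v2 x < +oo} by apply: filterS v2P => x; exact.
pose u1 x := v1 x * inner_weight p omega1 x.
pose u2 x := v2 x * outer_weight q omega2 x.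
have mu1 : measurable_fun setT u1 by exact: emeasurable_funM.
have mu2 : measurable_fun setT u2 by exact: emeasurable_funM.
have u1P : {ae mu, forall x, 0 < u1 x < +oo}.
  by apply: filterS2 v1P W1P => x; exact: pos_lt_mule.
have u2P : {ae mu, forall x, 0 < u2 x < +oo}.
  by apply: filterS2 v2P W2P => x; exact: pos_lt_mule.
transitivity (multiplier_norm mu p q u1 u2).
  have cLME f : measurable_fun setT f -> cLM_norm p%:E p%:E omega1 v1 f =
      'N[mu]_p%:E[(fun x => f x * u1 x)].
    by move=> mf; rewrite cLM_normE//; apply: eq_Lnorm => x; rewrite /u1 muleA.
  have LME f : measurable_fun setT f -> LM_norm q%:E q%:E omega2 v2 f =
      'N[mu]_q%:E[(fun x => f x * u2 x)].
    by move=> mf; rewrite LM_normE//; apply: eq_Lnorm => x; rewrite /u2 muleA.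
  apply/eqP; rewrite eq_le; apply/andP; split.
    have [->|] := eqVneq (multiplier_norm mu p q u1 u2) +oo; first exact: leey.
    rewrite -ltey => Moo.
    have M0 : 0 <= multiplier_norm mu p q u1 u2 by exact: Lnorm_ge0.
    have Mfin : multiplier_norm mu p q u1 u2 \is a fin_num by rewrite ge0_fin_numE.
    (* A finite multiplier norm is itself an admissible constant. *)
    apply: ereal_inf_lbound; exists (fine (multiplier_norm mu p q u1 u2)).
      split=> [|f]; first exact: fine_ge0.
      rewrite (fineK Mfin) => /(cLMP _ p0 homega1 mv1)[mf fy].
      have {}fy : 'N[mu]_p%:E[(fun x => f x * u1 x)] < +oo.
        by rewrite -cLME// cLM_normE.
      have le := Lnorm_multiplier_le q0 qp mu1 mu2 u1P u2P mf Moo fy.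
      split; last by rewrite LME// cLME.
      apply/(LMP _ q0 homega2 mv2); split=> //.
      rewrite -LM_normE// LME//; apply: le_lt_trans le _.
      by rewrite lte_mul_pinfty.
    by rewrite fineK.
  apply: le_ereal_inf_tmp => _ [c [c0 hc] <-].
  apply: multiplier_norm_le => // F mF Fy.
  rewrite -LME// -cLME//; apply: (hc F _).2.
  by apply/(cLMP _ p0 homega1 mv1); split=> //; rewrite -cLM_normE// cLME.
rewrite /wnorm_on /norm_on /multiplier_norm patch_setT.
apply: eq_Lnorm_ae.
- exact: exp_to_gt0.
- exact: (emeasurable_funM (measurableT_comp (@measurable_inve R) mu1) mu2).
- exact: (emeasurable_funM
    (emeasurable_funM (measurableT_comp (@measurable_inve R) mW1) mW2)
    (emeasurable_funM (measurableT_comp (@measurable_inve R) mv1) mv2)).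
(* Where [v1] and [W1] are finite, the inverse of [u1] is the product of their inverses and the
   factors can be regrouped. *)
apply: filterS2 v1P W1P => x /andP[v0 voo] /andP[w0 woo].
rewrite /u1 /u2 ge0_inveM; last 2 first.
- by rewrite ltW.
- by rewrite ltW.
by rewrite muleACA [RHS]muleC.
Qed.

End embedding.

Theorem theorem2p2 (R : realType) (n : nat) (p1 p2 theta1 theta2 : \bar R)
    (htheta2 : 0 < theta2) (htheta2p2 : theta2 = p2) (hp2p1 : p2 <= p1)
    (hp1theta1 : p1 = theta1) (htheta1 : theta1 < +oo) :
  exists lambda : R, (1 <= lambda)%R /\
    forall (v1 v2 : euclid R n -> \bar R) (omega1 omega2 : line R -> \bar R),
      weight lebesgue_euclid setT v1 ->
      weight lebesgue_euclid setT v2 ->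
      cOmega theta1 omega1 ->
      Omega theta2 omega2 ->
      let lhs :=
        embedding_norm
          (cLM p1 theta1 omega1 v1) (cLM_norm p1 theta1 omega1 v1)
          (LM p2 theta2 omega2 v2) (LM_norm p2 theta2 omega2 v2) in
      let rhs :=
        wnorm_on lebesgue_euclid (exp_to p1 p2) (fun x => (v1 x)^-1 * v2 x)
          setT
          (fun x => (norm_on completed_lebesgue_measure p1 `]0%R, euclid_norm x[ omega1)^-1 *
                    norm_on completed_lebesgue_measure p2 `]euclid_norm x, +oo[ omega2) in
      lambda^-1%:E * rhs <= lhs /\ lhs <= lambda%:E * rhs.
Proof.
exists 1%R; split=> // v1 v2 omega1 omega2; subst theta2 theta1.
have [q p2E] : exists q : R, p2 = q%:E.
  exists (fine p2); rewrite fineK// ge0_fin_numE ?(ltW htheta2)//.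
  exact: le_lt_trans hp2p1 htheta1.
have [p p1E] : exists p : R, p1 = p%:E.
  exists (fine p1); rewrite fineK// ge0_fin_numE//.
  exact: le_trans (ltW htheta2) hp2p1.
subst p1 p2; move: htheta2 hp2p1; rewrite lte_fin lee_fin => q0 qp.
move=> hv1 hv2 homega1 homega2 lhs rhs.
have -> : lhs = rhs by exact: embedding_norm_cLM_LM.
by rewrite invr1 !mul1e.
Qed.
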